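(* Let $p\ge 2$, let $n_1,\dots,n_p\ge 1$ be integers, $N=\sum_{i=1}^p n_i$, let $b\ge 0$ be an integer with $m:=p-b-1\ge 0$, and let $\tau=[N-b,1^b]$ (a hook partition of $N$). Let $2\le \ell\le p$ and $\mathcal{A}=\{1,2,\dots,\ell\}$. Then $$\chi^{\tau}[\mathcal{A};\mathbf{n}]=\frac{1}{\prod_{i=1}^{\ell}n_i}\left\{\sum_{k=0}^{\min(m,\ell)}\frac{(b+1)_{m-k}}{(m-k)!}\,e_{\ell-k}(n_1-1,n_2-1,\dots,n_\ell-1)+(-1)^{\ell+1}\frac{(b-\ell+1)_m}{m!}\right\}$$ and also $$\chi^{\tau}[\mathcal{A};\mathbf{n}]=\binom{b+m}{b}+\sum_{i=1}^{\min(b,\ell-1)}(-1)^i\binom{b+m-i}{b-i}\,e_i\!\left(\frac1{n_1},\frac1{n_2},\dots,\frac1{n_\ell}\right).$$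
   Context: $\mathcal{S}_N$ is the group of permutations of $\{1,\dots,N\}$. For a partition $\tau$ of $N$, $\chi^\tau$ denotes the character of the irreducible representation of $\mathcal{S}_N$ labeled by $\tau$ (so that $[N]$ labels the trivial representation and $[1^N]$ the sign representation); $[N-b,1^b]$ is the partition with one part $N-b$ and $b$ parts equal to $1$. Put $I_j=\{\sum_{i=1}^{j-1}n_i+1,\dots,\sum_{i=1}^{j}n_i\}$ for $1\le j\le p$, and let $G_{\mathbf{n}}\cong\mathcal{S}_{n_1}\times\cdots\times\mathcal{S}_{n_p}$ be the Young subgroup of $\mathcal{S}_N$ consisting of the permutations that map each $I_j$ onto itself; $\#G_{\mathbf n}=\prod_{i=1}^p n_i!$. For a set $\mathcal{A}=\{a_1,\dots,a_\ell\}\subset\{1,\dots,p\}$ with $\ell$ elements, let $g_{\mathcal{A}}\in\mathcal{S}_N$ be any cycle of length $\ell$ having exactly one entry in each interval $I_{a_1},\dots,I_{a_\ell}$, and define $$\chi^{\tau}[\mathcal{A};\mathbf{n}]:=\frac{1}{\#G_{\mathbf{n}}}\sum_{h\in G_{\mathbf{n}}}\chi^\tau(g_{\mathcal{A}}h)$$ (the value does not depend on the choice of such a cycle). $e_i$ is the elementary symmetric polynomial of degree $i$ ($e_0=1$), and $(a)_n=\prod_{i=1}^n(a+i-1)$ is the Pochhammer symbol, $(a)_0=1$. *)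

(* Defs.v *)
From HB Require Import structures.
From mathcomp Require Import all_boot all_order all_algebra all_fingroup.
From mathcomp Require Import all_solvable all_field all_character.
From mathcomp Require Import mpoly.

Set Implicit Arguments.
Unset Strict Implicit.
Unset Printing Implicit Defensive.

Import GRing.Theory Num.Theory.
Local Open Scope ring_scope.

(** The points are 0, ..., N-1.  A partition of N is a weakly decreasing
    [tau : seq nat] with positive parts and [sumn tau = N].  The Young diagram
    of [tau] is filled row by row with 0, ..., N-1, so that [x] sits in row
    [reshape_index tau x] and column [reshape_offset tau x]. *)

Definition row_stab (N : nat) (tau : seq nat) : {set 'S_N} :=
  [set h : 'S_N |
    [forall x, reshape_index tau (h x) == reshape_index tau x]].

Definition col_stab (N : nat) (tau : seq nat) : {set 'S_N} :=
  [set h : 'S_N |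
    [forall x, reshape_offset tau (h x) == reshape_offset tau x]].

Definition young_symmetrizer (N : nat) (tau : seq nat) :
    'M[algC]_#|[set: 'S_N]| :=
  \sum_(r in row_stab N tau) \sum_(c in col_stab N tau)
     (-1) ^+ c *: regular_repr algC [set: 'S_N] (r * c)%g.

(** The irreducible module labeled by [tau] is the right ideal generated by the
    Young symmetrizer in the group algebra of 'S_N, i.e. in the regular module,
    whose basis is indexed by 'S_N and on which 'S_N acts by right
    multiplication. *)
Definition specht_mx (N : nat) (tau : seq nat) : 'M[algC]_#|[set: 'S_N]| :=
  cyclic_mx (regular_repr algC [set: 'S_N])
            (gring_row (young_symmetrizer N tau)).

Definition specht_repr (N : nat) (tau : seq nat) :
    mx_representation algC [set: 'S_N] (\rank (specht_mx N tau)) :=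
  submod_repr (cyclic_mx_module (regular_repr algC [set: 'S_N])
                                (gring_row (young_symmetrizer N tau))).

Definition sym_char (N : nat) (tau : seq nat) : 'CF([set: 'S_N]) :=
  cfRepr (specht_repr N tau).

Definition hook (N b : nat) : seq nat := (N - b)%N :: nseq b 1%N.

Definition block (p : nat) (n : 'I_p -> nat) (N : nat) (j : 'I_p) :
    {set 'I_N} :=
  [set x : 'I_N |
    (\sum_(i < p | (i < j)%N) n i <= x < \sum_(i < p | (i <= j)%N) n i)%N].

Definition young_subgroup (p : nat) (n : 'I_p -> nat) (N : nat) : {set 'S_N} :=
  [set h : 'S_N | [forall j : 'I_p, h @: block n N j == block n N j]].

(** [next s] maps each entry of [s] to its cyclic successor and fixes every
    other point. *)
Definition is_cycle_through (p : nat) (n : 'I_p -> nat) (N : nat)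
    (A : {set 'I_p}) (g : 'S_N) : Prop :=
  exists s : seq 'I_N,
    [/\ uniq s, size s = #|A|, g =1 next s
      & forall a, a \in A -> count (mem (block n N a)) s = 1%N].

(** In 'S_N the product [g * h] is "first g, then h".  The opposite convention
    gives the same average, as a character is invariant under conjugation. *)
Definition char_avg (p : nat) (n : 'I_p -> nat) (N : nat)
    (chi : 'CF([set: 'S_N])) (g : 'S_N) : algC :=
  #|young_subgroup n N|%:R^-1 * \sum_(h in young_subgroup n N) chi (g * h)%g.

Definition pochhammer (R : pzRingType) (a : R) (n : nat) : R :=
  \prod_(1 <= i < n.+1) (a + i%:R - 1).

Definition elem_sym (l k : nat) (x : 'I_l -> algC) : algC :=
  (mesym l algC k).@[x].

(* Main.v *)
(** Up to normalization, the character of a hook at [g] counts with sign the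
    solutions of [y * x * g = x] with [y] running over the terms [r * k] of the
    Young symmetrizer [c], because [c] is proportional to an idempotent.  A coset
    decomposition of the symmetric groups involved then gives
    [chi_b (g) + chi_(b-1) (g) = ] the coefficient of ['X^b] in
    [\det (1 + 'X P_g)], where [P_g] is the permutation matrix: this is the
    splitting of the exterior powers of the permutation representation, obtained
    without exterior algebra.

    Averaging [\det (1 + A P_h)] over the Young subgroup replaces [P_h] by its
    mean, so the averaged generating function is a determinant of size [p] that
    involves a single weighted [l]-cycle:
    [(1 + 'X)^(p-l) (\prod_(i < l) (1 + 'X - 'X/n_i) - \prod_(i < l) (- 'X/n_i))].
    Dividing by [1 + 'X] and expanding in the [1/n_i], respectively in the
    [n_i - 1], gives the two formulas. *)

Require Import Defs.
From mathcomp Require Import all_boot all_order all_algebra all_fingroup.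
From mathcomp Require Import all_solvable all_field all_character mpoly.
From mathcomp Require Import zify ring.

Import GRing.Theory Num.Theory.
Local Open Scope ring_scope.

Set Implicit Arguments.
Unset Strict Implicit.
Unset Printing Implicit Defensive.

(** * Sums over permutations with prescribed support *)

Section PermOn.
Variable T : finType.
Implicit Types (A B L : {set T}) (o : T) (s : {perm T}).

Lemma perm_on_tperm A x y : x \in A -> y \in A -> perm_on A (tperm x y).
Proof.
move=> Ax Ay; apply/subsetP=> z; rewrite inE; case: tpermP => [-> //|-> //|].
by rewrite eqxx.
Qed.

Lemma perm_onP A s : reflect (forall x, x \notin A -> s x = x) (perm_on A s).
Proof.
apply: (iffP subsetP) => [H x nAx|H x]; last first.
  by rewrite inE; apply: contraNT => /H ->.
by apply/eqP; apply: contraNT nAx => sx; apply: H; rewrite inE.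
Qed.

(** Coset decomposition: [s] is sorted by the preimage [i] of [a], and removing the factor
    [tperm i a] leaves a permutation that fixes [a]. *)
Lemma sum_perm_on_setU1 (V : nmodType) (f : {perm T} -> V) (a : T) A :
  a \notin A ->
  \sum_(s | perm_on (a |: A) s) f s =
  \sum_(i in a |: A) \sum_(s | perm_on A s) f (tperm i a * s)%g.
Proof.
move=> nAa.
rewrite (partition_big (fun s : {perm T} => (s^-1)%g a) (mem (a |: A))) /=; last first.
  by move=> s sA; rewrite -(perm_closed _ sA) permKV setU11.
apply: eq_bigr => i aAi.
rewrite (reindex_inj (mulgI (tperm i a))) /=; apply: eq_bigl => s.
have tt : perm_on (a |: A) (tperm i a) by rewrite perm_on_tperm ?setU11.
apply/andP/idP => [[H1 /eqP H2]|H].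
  have H3 : perm_on (a |: A) s.
    have := perm_onM tt H1; rewrite mulgA tperm2 mul1g; exact.
  have sa : s a = a.
    have := permKV (tperm i a * s)%g a.
    by rewrite H2 permM tpermL.
  apply/perm_onP => x nAx; have [->//|nxa] := eqVneq x a.
  by apply: (out_perm H3); rewrite !inE negb_or nxa.
split.
  by apply: perm_onM => //; apply: subset_trans H _; apply: subsetUr.
apply/eqP; apply: (@perm_inj _ (tperm i a * s)%g); rewrite permKV permM tpermL.
by rewrite (out_perm H).
Qed.

Lemma sum_perm_on_inv (V : nmodType) (f : {perm T} -> V) A :
  \sum_(s | perm_on A s) f s = \sum_(s | perm_on A s) f (s^-1)%g.
Proof.
rewrite (reindex_inj invg_inj); apply: eq_bigl => s.
by apply/idP/idP => /perm_onV; rewrite ?invgK.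
Qed.

Lemma sum_perm_on_setU1r (V : nmodType) (f : {perm T} -> V) (a : T) A :
  a \notin A ->
  \sum_(s | perm_on (a |: A) s) f s =
  \sum_(i in a |: A) \sum_(s | perm_on A s) f (s * tperm i a)%g.
Proof.
move=> nAa; rewrite sum_perm_on_inv sum_perm_on_setU1 //.
apply: eq_bigr => i _; rewrite sum_perm_on_inv; apply: eq_bigr => s _.
by rewrite invMg invgK tpermV.
Qed.

Lemma sum_perm_on_mull (V : nmodType) (f : {perm T} -> V) A t : perm_on A t ->
  \sum_(s | perm_on A s) f (t * s)%g = \sum_(s | perm_on A s) f s.
Proof.
move=> At; rewrite [RHS](reindex_inj (mulgI t)); apply: eq_bigl => s.
apply/idP/idP => H; first exact: perm_onM.
by have := perm_onM (perm_onV At) H; rewrite mulKg.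
Qed.

Lemma sum_perm_on_mulr (V : nmodType) (f : {perm T} -> V) A t : perm_on A t ->
  \sum_(s | perm_on A s) f (s * t)%g = \sum_(s | perm_on A s) f s.
Proof.
move=> At; rewrite [RHS](reindex_inj (mulIg t)); apply: eq_bigl => s.
apply/idP/idP => H; first exact: perm_onM.
by have := perm_onM H (perm_onV At); rewrite mulgK.
Qed.

(** Both sequences are completed to enumerations of [T] by appending the missing points; [x] matches
    these position by position. *)
Lemma perm_map_uniq (s t : seq T) : uniq s -> uniq t -> size s = size t ->
  exists x : {perm T}, map x s = t.
Proof.
move=> us ut st.
pose c (u : seq T) := u ++ [seq z <- enum T | z \notin u].
have uc u : uniq u -> uniq (c u).
  move=> uu; rewrite cat_uniq uu filter_uniq ?enum_uniq // andbT.
  by apply/hasPn => z; rewrite mem_filter => /andP[].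
have mc u z : z \in c u.
  by rewrite mem_cat mem_filter mem_enum andbT orbN.
have sc u : uniq u -> size (c u) = #|T|.
  by move=> uu; rewrite -(card_uniqP (uc u uu)); apply: eq_card => z; rewrite mc.
case: s us st => [|z0 s] us st; first by exists 1%g; case: t ut st.
pose f z := nth z0 (c t) (index z (c (z0 :: s))).
have fi : injective f.
  move=> z1 z2 /eqP; rewrite nth_uniq ?uc ?(sc t) //.
  - by move=> /eqP /(congr1 (nth z0 (c (z0 :: s)))); rewrite !nth_index.
  - by rewrite -(sc _ us) index_mem.
  - by rewrite -(sc _ us) index_mem.
exists (perm fi); apply: (@eq_from_nth _ z0); rewrite size_map // => i lt.
rewrite (nth_map z0) // permE /f index_cat mem_nth // index_uniq //.
by rewrite nth_cat -st lt.
Qed.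

End PermOn.

Section PermSum.
Variables (T : finType) (R : pzRingType) (rho : {perm T} -> R).
Hypothesis rhoM : forall s t, rho (s * t)%g = rho s * rho t.
Implicit Types (A B L : {set T}) (s t : {perm T}).

Definition perm_sum A : R := \sum_(s | perm_on A s) rho s.

Lemma perm_sum_mull A t : perm_on A t -> rho t * perm_sum A = perm_sum A.
Proof.
move=> At; rewrite /perm_sum mulr_sumr -[RHS](sum_perm_on_mull _ At).
by apply: eq_bigr => s _; rewrite rhoM.
Qed.

Lemma perm_sum_mulr A t : perm_on A t -> perm_sum A * rho t = perm_sum A.
Proof.
move=> At; rewrite /perm_sum mulr_suml -[RHS](sum_perm_on_mulr _ At).
by apply: eq_bigr => s _; rewrite rhoM.
Qed.

Lemma perm_sum_sub A B : B \subset A ->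
  perm_sum B * perm_sum A = perm_sum A *+ #|B|`!.
Proof.
move=> sBA; rewrite {1}/perm_sum mulr_suml -card_perm -sumr_const.
by apply: eq_bigr => s Bs; apply/perm_sum_mull/(subset_trans Bs).
Qed.

Lemma perm_sum_setU1 A a : a \notin A ->
  perm_sum (a |: A) = \sum_(i in a |: A) rho (tperm i a) * perm_sum A.
Proof.
move=> nAa; rewrite /perm_sum sum_perm_on_setU1 //; apply: eq_bigr => i _.
by rewrite mulr_sumr; apply: eq_bigr => s _; rewrite rhoM.
Qed.

End PermSum.

(** * The square of a hook symmetrizer *)

Section HookSymmetrizer.
Variables (T : finType) (R : pzRingType) (rho : {perm T} -> R).
Hypothesis rhoM : forall s t, rho (s * t)%g = rho s * rho t.
Hypothesis eqN0 : forall x : R, x = - x -> x = 0.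

Definition sgn_twist (s : {perm T}) : R := (-1) ^+ s * rho s.

Lemma sgn_twistM s t : sgn_twist (s * t)%g = sgn_twist s * sgn_twist t.
Proof.
rewrite /sgn_twist rhoM odd_permM signr_addb -mulrA !mulr_sign.
by case: (odd_perm s); case: (odd_perm t); rewrite ?(mulNr, mulrN, opprK).
Qed.

Lemma perm_sum_comm (A L : {set T}) : [disjoint A & L] ->
  perm_sum rho A * perm_sum sgn_twist L
    = perm_sum sgn_twist L * perm_sum rho A.
Proof.
move=> dAL; rewrite /perm_sum mulr_suml mulr_sumr; apply: eq_bigr => s As.
rewrite mulr_sumr mulr_suml; apply: eq_bigr => t Lt.
have cst : rho s * rho t = rho t * rho s.
  by rewrite -!rhoM (perm_onC As Lt dAL).
by rewrite /sgn_twist !mulr_sign; case: ifP => _; rewrite ?mulrN ?mulNr cst.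
Qed.

(** The transposition of [x] and [y] is absorbed by the row sum with sign plus and by the signed
    column sum with sign minus, so the product is its own opposite. *)
Lemma perm_sum_garnir (A C : {set T}) x y : x != y ->
    x \in A -> y \in A -> x \in C -> y \in C ->
  perm_sum rho A * perm_sum sgn_twist C = 0.
Proof.
move=> nxy Ax Ay Cx Cy; apply: eqN0.
rewrite -[in RHS](perm_sum_mull (t := tperm x y) sgn_twistM) ?perm_on_tperm //.
rewrite mulrA /sgn_twist odd_tperm nxy expr1 mulN1r mulrN mulNr opprK.
by rewrite perm_sum_mulr ?perm_on_tperm.
Qed.

Variables (o : T) (A L : {set T}).
Hypotheses (nAo : o \notin A) (nLo : o \notin L) (dAL : [disjoint A & L]).

Let x := perm_sum rho (o |: A) * perm_sum sgn_twist (o |: L).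

Lemma disjoint_oAL : [disjoint o |: A & L].
Proof. by rewrite disjoints_subset subUset sub1set inE nLo -disjoints_subset. Qed.

(** The row enlarged by [j] shares both [o] and [j] with the column, so [perm_sum_garnir] kills the
    product. Splitting the enlarged row sum into cosets leaves 1 plus the sum of the [tperm i j],
    acting on [x]. *)
Lemma sum_tperm_garnir j : j \in L ->
  \sum_(i in o |: A) rho (tperm i j) * x = - x.
Proof.
move=> Lj; have njA : j \notin o |: A.
  by rewrite (disjointFl disjoint_oAL).
have := @perm_sum_garnir (j |: (o |: A)) (o |: L) o j.
rewrite perm_sum_setU1 // big_setU1 //= tperm1.
rewrite !inE !eqxx Lj !orbT /= => /(_ _ isT isT isT isT) H.
apply/eqP; rewrite -addr_eq0 addrC; apply/eqP; rewrite -[RHS]H; last first.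
  by apply: contraNneq nLo => ->.
rewrite mulrDl -mulrA -/x; congr (_ + _).
  by rewrite /x mulrA perm_sum_mull // perm_on1.
by rewrite mulr_suml; apply: eq_bigr => i _; rewrite -mulrA.
Qed.

(** Conjugation by a row permutation [s] turns [tperm j o] into the transposition of [j] and a point
    of the row, while [s] itself is absorbed by [x]. Each point of the row arises from |A|!
    permutations. *)
Lemma perm_sum_tperm j : j \in L ->
  perm_sum rho (o |: A) * (rho (tperm j o) * x) = - (x *+ #|A|`!).
Proof.
move=> Lj; rewrite -mulNrn -(sum_tperm_garnir Lj) // -sumrMnl /perm_sum mulr_suml.
have njA : j \notin o |: A by rewrite (disjointFl disjoint_oAL).
transitivity (\sum_(s | perm_on (o |: A) s) rho (tperm (s o) j) * x).
  rewrite [RHS]sum_perm_on_inv; apply: eq_bigr => s As.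
  have -> : tperm ((s^-1)%g o) j = (s * tperm j o * s^-1)%g.
    by rewrite tpermC -{1}(out_perm (perm_onV As) njA) -tpermJ /conjg invgK mulgA.
  rewrite !rhoM -!mulrA; congr (_ * (_ * _)).
  by rewrite /x mulrA perm_sum_mull // perm_onV.
rewrite sum_perm_on_setU1r //; apply: eq_bigr => i _.
rewrite -card_perm -sumr_const; apply: eq_bigr => s As.
by rewrite permM (out_perm As nAo) tpermR.
Qed.

(** Moving [(j o)] through the row sum produces [\sum_(i in row) (i j)], which
    acts on [x] as [-1] by the Garnir relation. *)
Lemma hook_symmetrizer_sq : x * x = x *+ (#|L|`! * #|A|`! * (#|A| + #|L|).+1).
Proof.
have xL : perm_sum sgn_twist L * x = x *+ #|L|`!.
  rewrite /x mulrA -perm_sum_comm ?disjoint_oAL // -mulrA.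
  by rewrite (perm_sum_sub sgn_twistM) ?subsetUr // mulrnAr.
(* Only the column sum of the left factor is split into cosets. Apart from the common factor |L|!,
   the identity contributes (|A| + 1)! and each [j] in [L] contributes |A|!, the sign of [tperm j o]
   cancelling the one in [perm_sum_tperm]. *)
rewrite {1}/x (perm_sum_setU1 sgn_twistM) // -mulrA.
rewrite mulr_suml mulr_sumr.
under eq_bigr => i _ do rewrite -mulrA xL !mulrnAr.
rewrite sumrMnl big_setU1 //= tperm1.
(* [rho] is only multiplicative; [rho 1] acts on [x] as the identity because the row sum absorbs
   it. *)
have -> : sgn_twist 1%g * x = x.
  rewrite /sgn_twist odd_perm1 expr0 mul1r.
  by rewrite /x mulrA perm_sum_mull // perm_on1.
rewrite {1}/x mulrA perm_sum_sub // mulrnAl -/x.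
rewrite (eq_bigr (fun=> x *+ #|A|`!)) => [|j Lj]; last first.
  rewrite /sgn_twist odd_tperm (contraNneq _ nLo) => [|<-//].
  by rewrite expr1 mulN1r mulNr mulrN perm_sum_tperm // opprK.
rewrite sumr_const -mulrnA -mulrnDr -mulrnA cardsU1 nAo add1n factS.
by congr (_ *+ _); nia.
Qed.

End HookSymmetrizer.

(** * Characters of the ideals generated by hook symmetrizers *)

(** The projector factors as [E = X *m B], where the rows of [B] form a basis of [U] and
    [B *m X = 1]; cyclicity of the trace then moves [X] to the other side. *)
Lemma mxtrace_submod (F : fieldType) (gT : finGroupType) (G : {group gT}) (n : nat)
    (rG : mx_representation F G n) (U : 'M[F]_n) (Umod : mxmodule rG U)
    (E : 'M[F]_n) (g : gT) :
  (E :=: U)%MS -> E *m E = E -> g \in G ->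
  \tr (submod_repr Umod g) = \tr (E *m rG g).
Proof.
move=> EU EE Gg; set B := val_submod (U := U) 1%:M.
have BU : (B :=: U)%MS := val_submod1 U.
have BE : B *m E = B.
  have /submxP[W ->] : (B <= E)%MS by rewrite EU BU.
  by rewrite -mulmxA EE.
have EB : E = in_submod U E *m B by rewrite -val_submodE in_submodK ?EU.
have BX : B *m in_submod U E = 1%:M.
  apply: (@val_submod_inj _ _ U); rewrite val_submodE -mulmxA -EB BE.
  by [].
move: (in_submod U E) EB BX => X -> BX.
rewrite -[in RHS]mulmxA [RHS]mxtrace_mulC.
have -> : B *m rG g = submod_repr Umod g *m B.
  by rewrite -val_submodE /= /submod_mx in_submodK // mxmodule_trans ?BU.
by rewrite -(mulmxA (submod_repr Umod g) B) BX mulmx1.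
Qed.

Section CyclicModule.
Variables (F : fieldType) (gT : finGroupType) (G : {group gT}).
Local Notation aG := (regular_repr F G).
Variables (C : 'M[F]_#|G|) (gam : F).
Hypotheses (gam0 : gam != 0) (CG : (C \in group_ring F G)%MS)
  (CC : C *m C = gam *: C).

(** Left multiplication by [C] commutes with the right action, has the ideal as its image, and
    becomes idempotent after division by [gam]. The trace on the ideal is thus a trace on the whole
    regular module. *)
Lemma mxtrace_cyclic_regular g : g \in G ->
  \tr (submod_repr (cyclic_mx_module aG (gring_row C)) g)
  = gam^-1 * \sum_(x in G) (gring_row C *m aG (x * g)%g) 0 (gring_index G x).
Proof.
move=> Gg; set u := gring_row C.
(* [lam] is left multiplication by [C], as a matrix acting on row vectors. *)
pose lam := enveloping_algebra_mx aG *m lin_mul_row u.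
have lamE v : v *m lam = u *m gring_mx aG v.
  by rewrite mulmxA -[v *m _]vec_mxK mul_vec_lin_row.
have lamJ (v : 'rV_#|G|) x : x \in G -> v *m aG x *m lam = v *m lam *m aG x.
  by move=> Gx; rewrite !lamE gring_mxJ // mulmxA.
have row_lam i : row i lam = u *m aG (enum_val i).
  by rewrite row_mul rowK mul_vec_lin_row.
have ulam : u *m lam = gam *: u.
  by rewrite lamE /u gring_rowK // -gring_row_mul CC linearZ.
have lam2 : lam *m lam = gam *: lam.
  apply/row_matrixP => i; rewrite row_mul row_lam lamJ ?enum_valP // ulam.
  by rewrite -scalemxAl linearZ /= row_lam.
rewrite (@mxtrace_submod _ _ _ _ _ _ _ (gam^-1 *: lam)) //; last 2 first.
- by apply: eqmx_trans (eqmx_scale _ _) (eqmx_sym (genmxE _)); rewrite invr_eq0.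
- by rewrite -scalemxAl -scalemxAr lam2 (scalerA _ gam) mulVf // scale1r.
rewrite -scalemxAl mxtraceZ; congr (_ * _); rewrite /mxtrace.
rewrite [RHS](reindex_onto enum_val (gring_index G)) /=; last first.
  by move=> x Gx; rewrite gring_indexK.
apply: eq_big => [i|i _]; first by rewrite enum_valP gring_valK eqxx.
rewrite gring_valK repr_mxM ?enum_valP // mulmxA -row_lam -row_mul.
by rewrite [RHS]mxE.
Qed.

End CyclicModule.

Lemma gring_row_regular (F : fieldType) (gT : finGroupType) (G : {group gT}) x y z :
  x \in G -> y \in G -> z \in G ->
  (gring_row (regular_repr F G x) *m regular_repr F G y) 0 (gring_index G z)
  = (x * y == z)%g%:R.
Proof.
move=> Gx Gy Gz; rewrite -gring_row_mul -repr_mxM // /gring_row rowK.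
rewrite gring_indexK // mul1g mxE eqxx /=.
by rewrite (can_in_eq (@gring_indexK _ G)) ?groupM // eq_sym.
Qed.

(** The linear extension of [psi] to the group algebra, evaluated at the Young symmetrizer with row
    [A] and column [C]. *)
Definition signed_sum (T : finType) (psi : {perm T} -> algC)
    (A C : {set T}) : algC :=
  \sum_(r | perm_on A r) \sum_(k | perm_on C k) (-1) ^+ k * psi (r * k)%g.

(** The trace of the two-sided translation [x |-> y * x * g] on the group algebra, where it permutes
    the basis. *)
Definition fix_count (T : finType) (g y : {perm T}) : algC :=
  \sum_x (y * x * g == x)%g%:R.

Lemma reshape_index_cons k sh i :
  reshape_index (k :: sh) i
    = if (i < k)%N then 0%N else (reshape_index sh (i - k)).+1.
Proof.
rewrite /reshape_index /= subn_eq0; case: ltnP => // le.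
by congr (find _ (scanl _ _ _)).+1; rewrite subSn.
Qed.

Lemma reshape_offset_cons k sh i :
  reshape_offset (k :: sh) i
    = if (i < k)%N then i else reshape_offset sh (i - k).
Proof.
rewrite /reshape_offset reshape_index_cons; case: ltnP => _ /=.
  by rewrite subn0.
by rewrite subnDA.
Qed.

Lemma reshape_index_ones b i : (i < b)%N -> reshape_index (nseq b 1%N) i = i.
Proof.
elim: b i => [|b IH] [|i] //= lt; rewrite reshape_index_cons //=.
by rewrite subn1 IH.
Qed.

Lemma reshape_offset_ones b i : (i < b)%N -> reshape_offset (nseq b 1%N) i = 0%N.
Proof.
elim: b i => [|b IH] [|i] //= lt; rewrite reshape_offset_cons //=.
by rewrite subn1 IH.
Qed.

Lemma card_ord_itv N a c : (a <= c)%N -> (c <= N)%N ->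
  #|[set x : 'I_N | (a <= x < c)%N]| = (c - a)%N.
Proof.
move=> ac cN; rewrite -sum1_card.
rewrite (eq_bigl (fun x : 'I_N => (x < c) && (a <= x))%N) => [|x]; last first.
  by rewrite inE andbC.
rewrite -(big_mkord (fun i => (i < c) && (a <= i))%N (fun=> 1%N)).
rewrite -(big_nat_widenl _ _ _ (fun i => (i < c)%N)) //.
by rewrite -(big_nat_widen _ _ _ predT) // sum_nat_const_nat muln1.
Qed.

(** * Stabilizers and character of a hook *)

Section Hook.
Variables (N b : nat).
Hypothesis ltbN : (b < N)%N.

Definition hook_row : {set 'I_N} := [set x : 'I_N | (x < N - b)%N].
Definition hook_col : {set 'I_N} :=
  [set x : 'I_N | (x == 0 :> nat) || (N - b <= x)%N].

(** Every row of a hook other than the first is a single box, so its point is fixed; the same holds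
    for the columns below. *)
Lemma row_stab_hook : row_stab N (hook N b) = [set h | perm_on hook_row h].
Proof.
apply/setP => h; rewrite !inE.
have E (x : 'I_N) : reshape_index (hook N b) x =
    if (x < N - b)%N then 0%N else (x - (N - b)).+1.
  rewrite reshape_index_cons; case: ltnP => // le; rewrite reshape_index_ones //.
  by have := ltn_ord x; lia.
apply/forallP/idP => [H|/perm_onP H x].
  apply/perm_onP => x; rewrite inE => nx; apply/val_inj => /=.
  by have := H x; rewrite !E (negPf nx); case: ifP => // ny /eqP; lia.
have [xr|nxr] := boolP (x \in hook_row); last by rewrite H.
have : h x \in hook_row by rewrite perm_closed //; apply/perm_onP.
by move: xr; rewrite !inE !E => -> ->.
Qed.

Lemma col_stab_hook : col_stab N (hook N b) = [set h | perm_on hook_col h].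
Proof.
apply/setP => h; rewrite !inE.
have E (x : 'I_N) : reshape_offset (hook N b) x =
    if (x < N - b)%N then nat_of_ord x else 0%N.
  rewrite reshape_offset_cons; case: ltnP => // le; rewrite reshape_offset_ones //.
  by have := ltn_ord x; lia.
apply/forallP/idP => [H|/perm_onP H x].
  apply/perm_onP => x; rewrite inE negb_or -ltnNge => /andP[x0 nx].
  apply/val_inj => /=.
  have := H x; rewrite !E nx; case: ifP => // ny /eqP // x0'.
    by move: x0; rewrite -x0'.
rewrite !E; have [xC|nxC] := boolP (x \in hook_col); last first.
  by rewrite H.
have: h x \in hook_col by rewrite perm_closed //; apply/perm_onP.
move: xC; rewrite !inE => xC hC.
by apply/eqP; case: ifP; case: ifP; lia.
Qed.

Definition hook_corner : 'I_N := Ordinal (leq_ltn_trans (leq0n b) ltbN).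
Definition hook_legs : {set 'I_N} := [set x : 'I_N | (N - b <= x)%N].
Definition hook_arm : {set 'I_N} := [set x : 'I_N | (0 < x < N - b)%N].

Lemma hook_rowE : hook_row = hook_corner |: hook_arm.
Proof. by apply/setP => x; rewrite !inE -val_eqE /=; lia. Qed.

Lemma hook_colE : hook_col = hook_corner |: hook_legs.
Proof. by apply/setP => x; rewrite !inE -val_eqE /=; lia. Qed.


Lemma card_hook_legs : #|hook_legs| = b.
Proof.
rewrite -[RHS](subKn (ltnW ltbN)) -[RHS](@card_ord_itv N) ?leq_subr //.
by apply: eq_card => x; rewrite !inE ltn_ord andbT.
Qed.

Lemma card_hook_arm : #|hook_arm| = (N - b.+1)%N.
Proof. by rewrite (card_ord_itv (N := N)); lia. Qed.

(** By [hook_symmetrizer_sq] the symmetrizer squares to the multiple b! (N-b-1)! N of itself. This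
    is the constant [gam] of [mxtrace_cyclic_regular], whose diagonal entries then count the
    solutions of [r * k * x * g = x]. *)
Lemma sym_char_hook g :
  sym_char N (hook N b) g
    = (b`! * (N - b.+1)`! * N)%:R^-1 * signed_sum (fix_count g) hook_row hook_col.
Proof.
pose aG := regular_repr algC [set: 'S_N].
have aGM s t : aG (s * t)%g = aG s * aG t by rewrite repr_mxM ?inE.
have eqN0 (x : 'M[algC]_#|[set: 'S_N]|) : x = - x -> x = 0.
  move=> E; apply/matrixP => i j; have := congr1 (fun M : 'M_ _ => M i j) E.
  rewrite !mxE => /eqP; rewrite -addr_eq0 -mulr2n mulrn_eq0 => /eqP ->.
  by [].
have YE : young_symmetrizer N (hook N b)
    = perm_sum aG hook_row * perm_sum (sgn_twist aG) hook_col.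
  rewrite /young_symmetrizer row_stab_hook col_stab_hook /perm_sum mulr_suml.
  apply: eq_big => [r|r _]; first by rewrite inE.
  rewrite mulr_sumr; apply: eq_big => [k|k _]; first by rewrite inE.
  rewrite -/(aG _) aGM /sgn_twist scaler_sign mulr_sign.
  by case: ifP; rewrite ?mulrN.
have := @hook_symmetrizer_sq _ _ _ aGM eqN0 hook_corner hook_arm hook_legs.
rewrite -hook_rowE -hook_colE -YE card_hook_legs card_hook_arm => sq.
set gam := (b`! * (N - b.+1)`! * N)%N.
rewrite /sym_char cfunE inE mulr1n.
rewrite (@mxtrace_cyclic_regular _ _ _ _ gam%:R); last 4 first.
- by rewrite pnatr_eq0 -lt0n !muln_gt0 !fact_gt0; lia.
- rewrite linear_sum summx_sub // => r _; rewrite linear_sum summx_sub // => c _.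
  by rewrite linearZ scalemx_sub ?envelop_mx_id ?inE.
- rewrite [LHS]sq ?inE -?val_eqE /= ?andbF //.
      by rewrite scaler_nat; congr (_ *+ (_ * _)); lia.
    by lia.
  by rewrite disjoints_subset; apply/subsetP => x; rewrite !inE; lia.
- by rewrite inE.
congr (_ * _).
under eq_bigr => x _.
  rewrite /young_symmetrizer linear_sum mulmx_suml summxE /=.
  under eq_bigr => r _.
    rewrite linear_sum mulmx_suml summxE /=.
    under eq_bigr => k _ do
      rewrite linearZ -scalemxAl mxE gring_row_regular ?inE // mulgA.
    over.
  over.
rewrite /= exchange_big row_stab_hook; apply: eq_big => [r|r _]; rewrite ?inE //.
rewrite exchange_big col_stab_hook; apply: eq_big => [k|k _]; rewrite ?inE //.
by rewrite -mulr_sumr /fix_count; congr (_ * _); apply: eq_bigl => x; rewrite inE.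
Qed.

End Hook.

(** * The branching identity for hook characters *)

Section SignedSum.
Variables (T : finType) (psi : {perm T} -> algC).
Implicit Types (A C L : {set T}).

(** For [o] outside [L] and [i] in [L], the coset of [tperm i o] enters with sign minus when the
    column is enlarged by [o] and with sign plus when the row is enlarged by [i]. These terms
    cancel, and one identity coset is left for each point of [T]. *)
Lemma signed_sum_branching L :
  \sum_(o in ~: L) signed_sum psi (~: L) (o |: L)
    + \sum_(i in L) signed_sum psi (i |: ~: L) L
  = #|T|%:R * signed_sum psi (~: L) L.
Proof.
set A := ~: L; set Phi := signed_sum psi A L.
pose tau i o := \sum_(r | perm_on A r) \sum_(k | perm_on L k)
  (-1) ^+ k * psi (r * (tperm i o * k))%g.
have addo o : o \in A -> signed_sum psi A (o |: L) = Phi - \sum_(i in L) tau i o.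
  rewrite inE => nLo; rewrite /signed_sum.
  under eq_bigr => r _ do rewrite sum_perm_on_setU1 // big_setU1 //=.
  rewrite big_split /=; congr (_ + _).
    by apply: eq_bigr => r _; apply: eq_bigr => k _; rewrite tperm1 mul1g.
  rewrite exchange_big -sumrN; apply: eq_bigr => i Li.
  rewrite -sumrN; apply: eq_bigr => r _; rewrite -sumrN; apply: eq_bigr => k _.
  have nio : i != o by apply: contraNneq nLo => <-.
  by rewrite odd_mul_tperm nio addTb signrN mulNr.
have addi i : i \in L -> signed_sum psi (i |: A) L = Phi + \sum_(o in A) tau i o.
  move=> Li; have nAi : i \notin A by rewrite inE negbK.
  rewrite /signed_sum sum_perm_on_setU1r // big_setU1 //=; congr (_ + _).
    by apply: eq_bigr => r _; apply: eq_bigr => k _; rewrite tperm1 mulg1.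
  apply: eq_bigr => o _; apply: eq_bigr => r _; apply: eq_bigr => k _.
  by rewrite tpermC mulgA.
rewrite (eq_bigr _ addo) (eq_bigr _ addi) sumrB big_split /=.
rewrite addrACA [X in - X + _]exchange_big /= addNr addr0 !sumr_const -mulrnDr.
by rewrite mulr_natl addnC cardsC.
Qed.

Hypothesis psiC : forall y z, psi (y * z)%g = psi (z * y)%g.

Lemma perm_on_conj (x : {perm T}) A s : perm_on (x @: A) (s ^ x)%g = perm_on A s.
Proof.
apply/perm_onP/perm_onP => H y nAy.
  have := H (x y); rewrite mem_imset //; last exact: perm_inj.
  by rewrite permJ => /(_ nAy) /perm_inj.
rewrite -(permKV x y) permJ H //.
by apply: contra nAy => /(imset_f x); rewrite permKV.
Qed.

Lemma signed_sum_conj (x : {perm T}) A C :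
  signed_sum psi (x @: A) (x @: C) = signed_sum psi A C.
Proof.
rewrite /signed_sum (reindex_inj (conjg_inj x)) /=.
apply: eq_big => [r|r _]; first by rewrite perm_on_conj.
rewrite (reindex_inj (conjg_inj x)) /=.
apply: eq_big => [k|k _]; first by rewrite perm_on_conj.
by rewrite odd_permJ -conjMg /conjg psiC mulgK.
Qed.

Lemma imset_permC (x : {perm T}) A : x @: (~: A) = ~: (x @: A).
Proof.
apply/setP => y; rewrite -(permKV x y) in_setC !mem_imset ?inE //; exact: perm_inj.
Qed.

Lemma imset_map_enum (x : {perm T}) A A' : map x (enum A) = enum A' -> x @: A = A'.
Proof.
move=> xA; apply/setP => y; rewrite -[RHS]mem_enum -xA.
by apply/imsetP/mapP => -[z Az ->]; exists z; rewrite ?mem_enum // in Az *.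
Qed.

Lemma signed_sum_card L L' : #|L| = #|L'| ->
  signed_sum psi (~: L) L = signed_sum psi (~: L') L'.
Proof.
move=> cL.
have [||| x xL] := @perm_map_uniq _ (enum L) (enum L'); rewrite ?enum_uniq //.
  by rewrite -!cardE.
have xLE := imset_map_enum xL.
by rewrite -(signed_sum_conj x) imset_permC xLE.
Qed.

(** A central [psi] is invariant under conjugation, and some permutation carries [o] and [L] to [o']
    and [L']. *)
Lemma signed_sum_hook_card o L o' L' : o \notin L -> o' \notin L' -> #|L| = #|L'| ->
  signed_sum psi (~: L) (o |: L) = signed_sum psi (~: L') (o' |: L').
Proof.
move=> nLo nLo' cL.
have [|||x [xo xL]] := @perm_map_uniq _ (o :: enum L) (o' :: enum L').
- by rewrite /= mem_enum nLo enum_uniq.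
- by rewrite /= mem_enum nLo' enum_uniq.
- by rewrite /= -!cardE cL.
have xLE := imset_map_enum xL.
by rewrite -(signed_sum_conj x) imset_permC imsetU1 xLE xo.
Qed.

End SignedSum.

Lemma fix_countC (T : finType) (g y z : {perm T}) :
  fix_count g (y * z)%g = fix_count g (z * y)%g.
Proof.
rewrite /fix_count [RHS](reindex_inj (mulgI z)) /=; apply: eq_bigr => x _.
by rewrite -!mulgA (inj_eq (mulgI z)) !mulgA.
Qed.

(** * The polynomial [\det (1 + 'X P_g)] and its coefficients *)

Section DetPerm.
Variable N : nat.
Implicit Types (g w : 'S_N) (L : {set 'I_N}).

(** The coefficient of ['X^b] is the character of the [b]-th exterior power of the permutation
    representation. *)
Definition perm_charpoly g : {poly algC} := \det (1%:M + 'X *: perm_mx g).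

(** The principal minor of the permutation matrix of [w] on [L]: the sign of the restriction of [w]
    if [w] preserves [L], and 0 otherwise. *)
Definition sgn_on L w : algC :=
  \sum_(k | perm_on L k && [forall i in L, w i == k i]) (-1) ^+ k.

(** In the Leibniz expansion, [L] collects the rows whose entry is taken from the ['X] summand; on
    the other rows the permutation is the identity. *)
Lemma perm_charpolyE w :
  perm_charpoly w = \sum_(L : {set 'I_N}) (sgn_on L w)%:P * 'X^#|L|.
Proof.
rewrite /perm_charpoly /determinant.
under eq_bigr => s _.
  under [X in _ * X]eq_bigr => i _ do rewrite !mxE addrC.
  rewrite bigA_distr mulr_sumr; over.
rewrite exchange_big /=; apply: eq_bigr => L _.
rewrite /sgn_on rmorph_sum mulr_suml [RHS]big_mkcond /=; apply: eq_bigr => s _.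
case: ifP => [/andP[/perm_onP Ls /forall_inP ws]|H].
  rewrite rmorph_sign; congr (_ * _).
  rewrite (eq_bigr (fun i => if i \in L then 'X else 1)) => [|i _].
    by rewrite -big_mkcond prodr_const.
  case: ifP => Li; first by rewrite ws // mulr1.
  by rewrite Ls ?Li ?eqxx.
have : ~~ [forall i, (i \in L) && (w i == s i) || (i \notin L) && (i == s i)].
  apply: contraFN H => /forallP H; apply/andP; split.
    by apply/perm_onP => i nLi; have := H i; rewrite (negPf nLi) /= => /eqP <-.
  by apply/forall_inP => i Li; have := H i; rewrite Li /= orbF.
case/forallPn => i; rewrite negb_or => /andP[Hi1 Hi2].
rewrite (bigD1 i) //=; case: (i \in L) Hi1 Hi2 => /= Hi1 Hi2.
  by rewrite (negPf Hi1) mulr0 mul0r mulr0.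
by rewrite (negPf Hi2) mul0r mulr0.
Qed.

Lemma perm_charpoly_conj g x : perm_charpoly (g ^ x)%g = perm_charpoly g.
Proof.
have xx : perm_mx (x^-1)%g *m perm_mx x = 1%:M :> 'M[{poly algC}]_N.
  by rewrite -perm_mxM mulVg perm_mx1.
rewrite /perm_charpoly /conjg !perm_mxM -[in LHS]xx.
have -> : perm_mx (x^-1)%g *m perm_mx x
      + 'X *: (perm_mx x^-1 *m (perm_mx g *m perm_mx x))
    = perm_mx (x^-1)%g *m (1%:M + 'X *: perm_mx g) *m perm_mx x
      :> 'M[{poly algC}]_N.
  by rewrite mulmxDr mulmxDl mulmx1 -scalemxAr -scalemxAl !mulmxA.
rewrite !det_mulmx mulrC mulrA -det_mulmx -perm_mxM mulgV perm_mx1 det1 mul1r.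
by [].
Qed.

Lemma perm_charpolyV g : perm_charpoly (g^-1)%g = perm_charpoly g.
Proof.
by rewrite /perm_charpoly -[RHS]det_tr linearD linearZ /= trmx1 tr_perm_mx.
Qed.

(** For given [x] and [k], the equation [r * k * x * g = x] has the single solution [r = w * k^-1],
    with [w] a conjugate of the inverse of [g]. This [r] fixes [L] pointwise exactly when [k] agrees
    with [w] on [L], so the sum over [k] is [sgn_on L w]. Each of the N! elements [x] then gives the
    same polynomial. *)
Lemma sum_signed_sum g b :
  \sum_(L : {set 'I_N} | #|L| == b) signed_sum (fix_count g) (~: L) L
    = (N`!)%:R * (perm_charpoly g)`_b.
Proof.
transitivity (\sum_(x : 'S_N) (perm_charpoly (g^-1 ^ x^-1)%g)`_b); last first.
  under eq_bigr => x _ do rewrite perm_charpoly_conj perm_charpolyV.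
  by rewrite sumr_const card_Sn mulr_natl.
under [RHS]eq_bigr => x _.
  rewrite perm_charpolyE coef_sum (bigID (fun L : {set 'I_N} => #|L| == b)) /=.
  rewrite [X in _ + X]big1 => [|L nL]; last first.
    by rewrite coefCM coefXn eq_sym (negPf nL) mulr0.
  rewrite addr0; under eq_bigr => L cL do rewrite coefCM coefXn eq_sym cL mulr1.
  over.
rewrite [RHS]exchange_big /=; apply: eq_bigr => L _.
rewrite /signed_sum; under [LHS]eq_bigr => r _.
  under eq_bigr => k _ do rewrite /fix_count mulr_sumr.
  rewrite exchange_big; over.
rewrite exchange_big /=; apply: eq_bigr => x _.
rewrite exchange_big /= /sgn_on.
set w := (g^-1 ^ x^-1)%g.
rewrite big_mkcondr /=; apply: eq_bigr => k Lk; rewrite -mulr_sumr.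
have wE r : (r * k * x * g == x)%g = (r == w * k^-1)%g.
  rewrite /w /conjg invgK !mulgA.
  by apply/eqP/eqP => [H|->]; [rewrite -{1}H !mulgK | rewrite !mulgKV].
under eq_bigr => r _ do rewrite wE.
have E : perm_on (~: L) (w * k^-1)%g = [forall i in L, w i == k i].
  apply/perm_onP/forall_inP => [H i Li|H i].
    by have := H i; rewrite inE negbK permM => /(_ Li) {2}<-; rewrite permKV.
  by rewrite inE negbK permM => /H /eqP ->; rewrite permK.
rewrite -E; case: ifP => wk.
  by rewrite (bigD1 (w * k^-1)%g) //= eqxx big1 ?addr0 ?mulr1 // => r /andP[_ /negPf->].
rewrite big1 ?mulr0 // => r rL; case: eqP => // rE; by rewrite -rE rL in wk.
Qed.
End DetPerm.

Lemma sym_char_hook_branching N b g : (b < N)%N ->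
  sym_char N (hook N b) g
    + (if b is b'.+1 then sym_char N (hook N b') g else 0) = (perm_charpoly g)`_b.
Proof.
move=> ltbN.
have psiC := fix_countC g; set psi := fix_count g in psiC *.
(* [Th c] belongs to the hook with [c] boxes below the corner; by [ThE] any corner and any leg set
   of that size give the same value. *)
pose Th c := signed_sum psi (hook_row N c) (hook_col N c).
have rowE c (lt : (c < N)%N) : hook_row N c = ~: hook_legs N c.
  by apply/setP => x; rewrite !inE; lia.
have ThE c (L : {set 'I_N}) o : (c < N)%N -> #|L| = c -> o \notin L ->
    signed_sum psi (~: L) (o |: L) = Th c.
  move=> lt cL nLo; rewrite /Th rowE // (hook_colE lt).
  by apply: signed_sum_hook_card; rewrite ?inE ?card_hook_legs //=; lia.
set L := hook_legs N b.
have cL : #|L| = b by rewrite card_hook_legs.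
have cLC : #|~: L| = (N - b)%N by rewrite cardsCs setCK card_ord cL.
have := signed_sum_branching psi L.
rewrite card_ord (eq_bigr (fun=> Th b)) => [|o]; last first.
  by rewrite inE => nLo; apply: ThE.
rewrite sumr_const cLC.
have -> : \sum_(i in L) signed_sum psi (i |: ~: L) L = Th b.-1 *+ b.
  rewrite (eq_bigr (fun=> Th b.-1)) ?sumr_const ?cL // => i Li.
  (* The point [i] becomes the corner of a hook whose leg set is [L] without [i], of size
     [b - 1]. *)
  have -> : i |: ~: L = ~: (L :\ i) by rewrite setCD setUC.
  rewrite -{2}(setD1K Li); apply: ThE; rewrite ?setD11 //; first by lia.
  by have := cardsD1 i L; rewrite Li cL; lia.
move=> br; have := sum_signed_sum g b.
rewrite (eq_bigr (fun=> signed_sum psi (~: L) L)) => [|L' /eqP cL']; last first.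
  by apply: signed_sum_card; rewrite // cL' cL.
rewrite sumr_const -[#|_|]/#|[pred L' : {set 'I_N} | #|L'| == b]| -cardsE.
rewrite card_draws card_ord => dr.
have Nfact := bin_fact (ltnW ltbN).
have f0 k : (k`!)%:R != 0 :> algC by rewrite pnatr_eq0 -lt0n fact_gt0.
have N0 : N%:R != 0 :> algC by rewrite pnatr_eq0; lia.
(* The multiplicities [b] and [N - b] bring the constants of both characters to the common value b!
   (N-b)! N. For [b = 0] the multiplicity 0 matches the missing character. *)
have ThS : (if b is b'.+1 then sym_char N (hook N b') g else 0) =
   (b`! * (N - b)`! * N)%:R^-1 * (Th b.-1 *+ b).
  case: (b) ltbN => [|b'] lt; first by rewrite mulr0n mulr0.
  rewrite sym_char_hook ?(ltnW lt) //= -/psi -/(Th b').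
  rewrite -[Th _ *+ _]mulr_natl mulrA; congr (_ * _); rewrite factS -!mulnA !natrM.
  have : b'.+1%:R != 0 :> algC by rewrite pnatr_eq0.
  by move: (b'.+1%:R : algC) => c c0; field; rewrite !f0 c0 N0.
have ThB : sym_char N (hook N b) g = (b`! * (N - b)`! * N)%:R^-1 * (Th b *+ (N - b)).
  rewrite sym_char_hook // -/psi -/(Th b) -[Th b *+ _]mulr_natl mulrA; congr (_ * _).
  have -> : (N - b = (N - b.+1).+1)%N by lia.
  rewrite factS -!mulnA !natrM.
  have : (N - b.+1).+1%:R != 0 :> algC by rewrite pnatr_eq0.
  by move: ((N - b.+1).+1%:R : algC) => c c0; field; rewrite !f0 c0 N0.
rewrite ThS ThB -mulrDr br.
have C0 : ('C(N, b))%:R != 0 :> algC by rewrite pnatr_eq0 -lt0n bin_gt0 ltnW.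
rewrite -[RHS](mulKf (f0 N)) -dr -[_ *+ 'C(N, b)]mulr_natl -Nfact !natrM.
by set P := signed_sum _ _ _; field; rewrite !f0 N0 C0.
Qed.

(** * Averaging a determinant over a Young subgroup *)

Section BlockDet.
Variable (R : comNzRingType).

Lemma det_border n (B : 'M[R]_n) (u : 'rV_n) (w : 'cV_n) :
  \det (block_mx 1%:M (- u) w B) = \det (B + w *m u).
Proof.
have -> : block_mx 1%:M (- u) w B
    = block_mx (1%:M : 'M_1) 0 w 1%:M *m block_mx 1%:M (- u) 0 (B + w *m u).
  rewrite mulmx_block !mul1mx !mulmx1 !mul0mx ?(mulmx0, addr0).
  by rewrite mulmxN addrCA addNr addr0.
by rewrite det_mulmx det_lblock det_ublock !det1 !mul1r.
Qed.

(** This is the row [u *m \adj B], written through cofactors of a bordered matrix. *)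
Definition rank1_coef n (B : 'M[R]_n) (u : 'rV_n) : 'rV_n :=
  \row_i cofactor (block_mx (1%:M : 'M_1) (- u) 0 B) (rshift 1 i) (lshift n 0).

(** The bordered determinant is expanded along its first column, whose cofactors do not depend on
    [w]; the case [w = 0] identifies the constant term. *)
Lemma det_add_rank1 n (B : 'M[R]_n) (u : 'rV_n) (w : 'cV_n) :
  \det (B + w *m u) = \det B + (rank1_coef B u *m w) 0 0.
Proof.
have colE (v : 'cV_n) :
    col' (lshift n 0) (block_mx (1%:M : 'M_1) (- u) v B) = col_mx (- u) B.
  apply/matrixP => x y; rewrite mxE.
  have -> : lift (lshift n 0) y = rshift 1 y.
    by apply/val_inj; rewrite /= /bump /= add1n.
  rewrite -[x]splitK; case: split => z /=.
    by rewrite block_mxEur col_mxEu.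
  by rewrite block_mxEdr col_mxEd.
have cof (v : 'cV_n) i : cofactor (block_mx 1%:M (- u) v B) i (lshift n 0)
    = cofactor (block_mx (1%:M : 'M_1) (- u) 0 B) i (lshift n 0).
  by rewrite /cofactor !colE.
have D (v : 'cV_n) : \det (B + v *m u)
   = cofactor (block_mx (1%:M : 'M_1) (- u) 0 B) (lshift n 0) (lshift n 0)
     + (rank1_coef B u *m v) 0 0.
  rewrite -det_border (expand_det_col _ (lshift n 0)) big_split_ord /=.
  rewrite big_ord1 block_mxEul mxE eqxx mul1r cof; congr (_ + _).
  rewrite mxE; apply: eq_bigr => i _.
  by rewrite block_mxEdl cof mxE mulrC.
have := D 0; rewrite mul0mx addr0 mulmx0 mxE addr0 => ->; exact: D.
Qed.

(** Sylvester's identity, from two block triangular factorizations of one matrix. *)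
Lemma det_1D_mulmxC m n (A : 'M[R]_(m, n)) (B : 'M_(n, m)) :
  \det (1%:M + A *m B) = \det (1%:M + B *m A).
Proof.
have E1 : block_mx 1%:M (- A) B 1%:M
    = block_mx 1%:M 0 B 1%:M *m block_mx 1%:M (- A) 0 (1%:M + B *m A).
  rewrite mulmx_block !mul1mx !mulmx1 !mul0mx ?(mulmx0, addr0).
  by rewrite mulmxN addrCA addNr addr0.
have E2 : block_mx 1%:M (- A) B 1%:M
    = block_mx 1%:M (- A) 0 1%:M *m block_mx (1%:M + A *m B) 0 B 1%:M.
  rewrite mulmx_block !mul1mx !mulmx1 !mul0mx ?(mulmx0, add0r, addr0).
  by rewrite mulNmx addrK.
have := congr1 determinant E1; rewrite E2 !det_mulmx !(det_lblock, det_ublock).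
by rewrite !det1 !mul1r !mulr1.
Qed.

End BlockDet.

Lemma row_perm_mx (R : pzRingType) n (s : 'S_n) i :
  row i (perm_mx s) = delta_mx 0 (s i) :> 'rV[R]_n.
Proof. by apply/rowP => j; rewrite !mxE eq_sym. Qed.

Section Averaging.
Variables (R : idomainType) (N : nat) (I : finType) (beta : 'I_N -> I).
Hypothesis two_neq0 : 2%:R != 0 :> R.

Definition block_perm : {set 'S_N} := [set h : 'S_N | [forall x, beta (h x) == beta x]].

Lemma block_permP (h : 'S_N) :
  reflect (forall x, beta (h x) = beta x) (h \in block_perm).
Proof. by rewrite inE; apply: (iffP forallP) => H x; apply/eqP. Qed.

Definition det_block_sum (A : 'M[R]_N) : R :=
  \sum_(h in block_perm) \det (1%:M + A *m perm_mx h).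

Lemma det_block_sum_mulr A t : t \in block_perm ->
  det_block_sum (A *m perm_mx t) = det_block_sum A.
Proof.
move=> /block_permP Gt; rewrite /det_block_sum [RHS](reindex_inj (mulgI t)) /=.
apply: eq_big => [h|h _]; last by rewrite perm_mxM mulmxA.
apply/block_permP/block_permP => H x; first by rewrite permM H Gt.
by rewrite -[x](permKV t) -permM H Gt.
Qed.

(** [w |-> det_block_sum (A + w *m u)] is affine, and right multiplication by the
    transposition of [i] and [j], which fixes the sum, changes the sign of
    [u = e_i - e_j]: the linear part is its own opposite. *)
Lemma det_block_sum_shift A (w : 'cV_N) i j : beta i = beta j ->
  det_block_sum (A + w *m (delta_mx 0 i - delta_mx 0 j)) = det_block_sum A.
Proof.
move=> bij; set u := _ - _.
pose c := \sum_(h in block_perm) rank1_coef (1%:M + A *m perm_mx h) (u *m perm_mx h).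
have FE v : det_block_sum (A + v *m u) = det_block_sum A + (c *m v) 0 0.
  rewrite /det_block_sum /c mulmx_suml summxE -big_split /=; apply: eq_bigr => h _.
  by rewrite mulmxDl addrA -mulmxA det_add_rank1.
set t := tperm i j.
have Gt : t \in block_perm.
  by apply/block_permP => x; rewrite /t; case: tpermP => [->|->|].
have dt k : delta_mx 0 k *m perm_mx t = delta_mx 0 (t k) :> 'rV[R]_N.
  by rewrite -rowE row_perm_mx.
have ut : u *m perm_mx t = - u.
  by rewrite mulmxBl !dt tpermL tpermR opprB.
(* A transposition is the reflection along [u]; for [i = j] both are trivial. *)
have tE : perm_mx t = 1%:M - u^T *m u :> 'M[R]_N.
  apply/row_matrixP => k; rewrite row_perm_mx linearB /= row1 row_mul.
  rewrite [row k u^T]mx11_scalar !mxE !eqxx /= mul_scalar_mx /t.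
  case: tpermP => [->|->|/eqP nki /eqP nkj].
  - have [->|nij] := eqVneq i j; first by rewrite eqxx subrr scale0r subr0.
    by rewrite eqxx subr0 scale1r opprB addrC subrK.
  - have [->|nij] := eqVneq j i; first by rewrite eqxx subrr scale0r subr0.
    by rewrite eqxx sub0r scaleN1r opprK addrC subrK.
  by rewrite (negPf nki) (negPf nkj) subrr scale0r subr0.
pose w0 := - (A *m u^T).
(* Since [A *m perm_mx t = A + w0 *m u] and [u] changes sign, the transposition replaces [v] by
   [w0 - v]. At [v = 0] this forces the linear part to vanish on [w0]. *)
have H v : det_block_sum (A + v *m u) = det_block_sum (A + (w0 - v) *m u).
  rewrite -(det_block_sum_mulr _ Gt) mulmxDl -mulmxA ut tE mulmxBr mulmx1.
  by rewrite mulmxBl mulNmx mulmxN addrA -!mulmxA.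
have cw0 : (c *m w0) 0 0 = 0.
  have := H 0; rewrite mul0mx addr0 subr0 FE => /eqP.
  by rewrite -subr_eq0 opprD addrA subrr sub0r oppr_eq0 => /eqP.
have := H w; rewrite !FE mulmxBr [in RHS]mxE cw0 add0r [in RHS]mxE => /addrI /eqP.
rewrite -addr_eq0 -mulr2n -mulr_natl mulf_eq0 (negPf two_neq0) /= => /eqP ->.
by rewrite addr0.
Qed.

Variable c : I -> R.
Hypothesis cE : forall i, c (beta i) * #|[set j | beta j == beta i]|%:R = 1.

(** With [cE], this is the mean of the permutation matrices of [block_perm]. *)
Definition block_proj : 'M[R]_N :=
  \matrix_(i, j) (if beta j == beta i then c (beta i) else 0).

(** The matrix [1 - block_proj] is a sum of rank-one matrices with row [e_i - e_j], for [i] and [j]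
    in one block, and [det_block_sum_shift] removes them one by one. Then
    [block_proj *m perm_mx h = block_proj] makes all summands equal. *)
Lemma det_block_sumE A :
  det_block_sum A = #|block_perm|%:R * \det (1%:M + A *m block_proj).
Proof.
transitivity (det_block_sum (A *m block_proj)); last first.
  rewrite /det_block_sum mulr_natl -sumr_const; apply: eq_bigr => h /block_permP Gh.
  rewrite -mulmxA; congr (\det (_ + _ *m _)).
  rewrite -[h]invgK -col_permE; apply/matrixP => i j; rewrite !mxE.
  by rewrite -[in RHS](permKV h j) Gh.
have D : 1%:M - block_proj = \sum_i \sum_(j | beta j == beta i)
    (c (beta i) *: delta_mx i 0) *m (delta_mx 0 i - delta_mx 0 j : 'rV_N).
  apply/row_matrixP => k; rewrite linearB /= row1 linear_sum (bigD1 k) //=.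
  rewrite [X in _ = _ + X]big1 => [|i nik]; last first.
    rewrite linear_sum big1 // => j _ /=; rewrite -scalemxAl linearZ /= row_mul.
    rewrite [row k _]mx11_scalar !mxE eqxx andbT eq_sym (negPf nik).
    by rewrite mul_scalar_mx scale0r scaler0.
  rewrite addr0 linear_sum /=.
  under eq_bigr => j _.
    rewrite -scalemxAl linearZ /= row_mul [row k _]mx11_scalar !mxE !eqxx.
    rewrite mul_scalar_mx scale1r; over.
  rewrite -scaler_sumr sumrB sumr_const scalerBr -scaler_nat scalerA.
  rewrite -[#|_|]/#|[pred j | beta j == beta k]| -cardsE cE scale1r.
  congr (_ - _); apply/rowP => j; rewrite !mxE summxE.
  case: ifP => bjk; last first.
    rewrite big1 ?mulr0 // => i bik; rewrite mxE eqxx /=.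
    by case: eqP => // ji; rewrite ji bik in bjk.
  rewrite (bigD1 j) //= mxE !eqxx big1 ?addr0 ?mulr1 // => i /andP[_ nij].
  by rewrite mxE eq_sym (negPf nij).
have {1}-> : A = A *m block_proj + A *m (1%:M - block_proj).
  by rewrite -mulmxDr addrC subrK mulmx1.
rewrite D mulmx_sumr.
elim/big_rec: _ (A *m block_proj) => [|i X _ IH] B; first by rewrite addr0.
rewrite addrA IH mulmx_sumr.
elim/big_rec: _ {IH X} B => [|j X /eqP bji IH] B; first by rewrite addr0.
by rewrite addrA IH mulmxA det_block_sum_shift.
Qed.

End Averaging.

(** * The determinant of a weighted cycle *)

Section CycleDet.
Variables (p : nat) (t : seq 'I_p).
Hypotheses (ut : uniq t) (t2 : (1 < size t)%N).

Definition next_perm : 'S_p := perm (can_inj (prev_next ut)).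

Definition cycle_mx (R : comNzRingType) (a c : 'I_p -> R) : 'M[R]_p :=
  \matrix_(i, j) ((i == j)%:R * a i + ((i \in t) && (next t i == j))%:R * c i).

Lemma next_closed_mem (Q : pred 'I_p) i j :
  i \in t -> Q i -> (forall k, k \in t -> Q k -> Q (next t k)) -> j \in t -> Q j.
Proof.
move=> ti Qi QS tj.
have /iter_findex <- : fconnect (next t) i j.
  by rewrite (fconnect_cycle (cycle_next ut)).
elim: (findex _ _ _) => [//|k IH] /=; apply: QS => //.
by elim: k {IH} => //= k IH; rewrite mem_next.
Qed.

Lemma next_neq i : i \in t -> next t i != i.
Proof.
move=> ti; apply: contraTneq t2 => nti; rewrite -leqNgt.
apply: (@leq_trans (size [:: i])) => //; apply: uniq_leq_size => // j tj.
rewrite inE; apply: (@next_closed_mem (pred1 i) i j) => //=.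
by move=> k _ /eqP ->; rewrite nti.
Qed.

(** A permutation contributing to the Leibniz sum fixes each point or moves it as [next t] does. If
    it moves one entry it moves the successor too, by injectivity, hence all of [t]; only the
    identity and the full cycle remain. *)
Lemma det_cycle_mx_sgn (R : comNzRingType) (a c : 'I_p -> R) :
  \det (cycle_mx a c) =
  \prod_i a i + (-1) ^+ next_perm * \prod_i (if i \in t then c i else a i).
Proof.
have npE i : next_perm i = next t i by rewrite permE.
have [i0 ti0] : exists i0, i0 \in t.
  by case: (t) t2 => // x s _; exists x; rewrite mem_head.
have nid : next_perm != 1%g.
  apply: contraNneq (next_neq ti0) => E; by rewrite -npE E perm1.
rewrite /determinant (bigD1 1%g) //= (bigD1 next_perm) //=.
rewrite [X in _ + (_ + X)]big1 ?addr0.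
  congr (_ + _ * _).
    rewrite odd_perm1 expr0 mul1r; apply: eq_bigr => i _; rewrite mxE perm1 eqxx mul1r.
    case ti: (i \in t); last by rewrite mul0r addr0.
    by rewrite (negPf (next_neq ti)) mul0r addr0.
  apply: eq_bigr => i _; rewrite mxE npE; case ti: (i \in t); last first.
    rewrite next_nth ti eqxx mul1r mul0r addr0.
    by [].
  by rewrite eq_sym (negPf (next_neq ti)) mul0r add0r eqxx mul1r.
move=> s /andP[s1 sn].
suff [i Hi] : exists i, (i != s i) && ~~ ((i \in t) && (next t i == s i)).
  case/andP: Hi => H1 H2; rewrite (bigD1 i) //= mxE (negPf H1) (negPf H2).
  by rewrite !mul0r addr0 mul0r mulr0.
apply/existsP; apply: contraT; rewrite negb_exists => /forallP H.
have {}H i : s i = i \/ i \in t /\ s i = next t i.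
  have := H i; rewrite negb_and !negbK => /orP[/eqP<-|/andP[? /eqP<-]]; first by left.
  by right.
have [i si] : exists i, s i != i.
  apply/existsP; apply: contraR s1; rewrite negb_exists => /forallP E.
  by apply/eqP/permP => i; rewrite perm1; apply/eqP; have := E i; rewrite negbK.
have ti : i \in t by case: (H i) => [E|[]] //; rewrite E eqxx in si.
case/eqP: sn; apply/permP => j; rewrite npE.
have [tj|ntj] := boolP (j \in t); last first.
  by rewrite next_nth (negPf ntj); case: (H j) => // -[tj]; rewrite tj in ntj.
apply/eqP; apply: (@next_closed_mem (fun k => s k == next t k) i j) => //.
  by case: (H i) => [E|[_ ->]] //; rewrite E eqxx in si.
move=> k tk /eqP sk; case: (H (next t k)) => [E|[_ ->]] //.
have := next_neq tk; move: E; rewrite -[RHS]sk => /perm_inj ->.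
by rewrite eqxx.
Qed.

(** The sign of the cycle is read off from [\det (1 - P) = 0], the indicator of
    [t] being in the kernel. *)
Lemma odd_next_perm : odd_perm next_perm = ~~ odd (size t).
Proof.
pose M := cycle_mx (fun=> 1 : algC) (fun=> -1).
have : \det M = 0.
  apply/eqP; rewrite -det_tr; apply/det0P; exists (\row_i (i \in t)%:R).
    case: (t) t2 => // x s _; apply/eqP => /rowP/(_ x)/eqP.
    by rewrite !mxE mem_head oner_eq0.
  apply/rowP => i; rewrite !mxE.
  under eq_bigr => j _ do rewrite !mxE mulrDr.
  rewrite big_split /= (bigD1 i) //= big1 => [|j nji]; last first.
    by rewrite eq_sym (negPf nji) mul0r mulr0.
  rewrite eqxx !mulr1 addr0; case ti: (i \in t); last first.
    by rewrite big1 ?addr0 // => j _; rewrite /= mul0r mulr0.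
  rewrite (bigD1 (next t i)) //= big1 => [|j nji]; last first.
    by rewrite eq_sym (negPf nji) mul0r mulr0.
  by rewrite mem_next ti eqxx !mul1r addr0 subrr.
rewrite det_cycle_mx_sgn big1 // -big_mkcond prodr_const => /eqP.
rewrite (card_uniqP ut) -(signr_odd _ (size t)) -signr_addb.
have n11 : 1 + 1 != 0 :> algC by rewrite -(natrD _ 1 1) pnatr_eq0.
by case: odd_perm; case: odd; rewrite //= expr0 (negPf n11).
Qed.

Lemma det_cycle_mx (R : comNzRingType) (a c : 'I_p -> R) :
  \det (cycle_mx a c) =
  \prod_i a i - \prod_i (if i \in t then - c i else a i).
Proof.
rewrite det_cycle_mx_sgn odd_next_perm; congr (_ + _).
rewrite (bigID (mem t)) [in RHS](bigID (mem t)) /=.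
rewrite (eq_bigr c) => [|i ->] //.
rewrite [X in - (X * _)](eq_bigr (fun i => - c i)) => [|i ->] //.
rewrite prodrN (card_uniqP ut) -(signr_odd _ (size t)) signrN mulrA -!mulNr.
by congr (_ * _ * _); apply: eq_bigr => i /negPf ->.
Qed.

End CycleDet.

Lemma next_map_in (T U : eqType) (f : T -> U) (s : seq T) x :
  uniq (map f s) -> x \in s -> next (map f s) (f x) = f (next s x).
Proof.
move=> ufs xs; have us := map_uniq ufs.
have [i s' E] := rot_to xs.
rewrite -(next_rot i us) -(next_rot i ufs) -map_rot E.
by case: s' {E} => [|y s'] /=; rewrite !eqxx.
Qed.

(** * Blocks and the averaged generating function *)

Section Blocks.
Variables (p : nat) (n : 'I_p -> nat) (N : nat).
Hypothesis NE : N = (\sum_(i < p) n i)%N.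

Let S k := (\sum_(i < p | (i < k)%N) n i)%N.

Let S_mono k k' : (k <= k')%N -> (S k <= S k')%N.
Proof.
move=> kk'; rewrite /S [leqRHS](bigID (fun i : 'I_p => (i < k)%N)) /=.
rewrite -[leqLHS]addn0 leq_add //; apply/eq_leq/eq_bigl => i; lia.
Qed.

Let S_succ (j : 'I_p) : S j.+1 = (S j + n j)%N.
Proof.
rewrite /S (bigD1 j) //= addnC; congr addn; apply: eq_bigl => i.
by rewrite -val_eqE /=; lia.
Qed.

Let SpE : S p = N.
Proof. by rewrite NE; apply: eq_bigl => i; rewrite ltn_ord. Qed.

Let in_blockE (x : 'I_N) j : (x \in block n N j) = (S j <= x < S j.+1)%N.
Proof. by rewrite inE. Qed.

Lemma card_block j : #|block n N j| = n j.
Proof.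
rewrite (@card_ord_itv N (S j) (S j.+1)) ?S_mono // -?SpE ?S_mono ?ltn_ord //.
by rewrite S_succ addKn.
Qed.

Lemma block_index_exists : exists beta : 'I_N -> 'I_p,
  forall x j, (x \in block n N j) = (beta x == j).
Proof.
have H (x : 'I_N) : exists k, (x < S k)%N by exists p; rewrite SpE ltn_ord.
(* The block of [x] has the index preceding the least [k] with [x < S k]; that [k] is positive
   because [S 0 = 0]. *)
have ltp (x : 'I_N) : ((ex_minn (H x)).-1 < p)%N.
  case: ex_minnP => -[|k] lt /(_ p); rewrite SpE ltn_ord => /(_ isT) //=.
  by move: lt; rewrite /S big_pred0.
exists (fun x => Ordinal (ltp x)) => x j; rewrite in_blockE -val_eqE /=.
case: ex_minnP => -[|k] lt kmin /=; first by move: lt; rewrite /S big_pred0.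
have le : (S k <= x)%N.
  by rewrite leqNgt; apply/negP => /kmin; rewrite ltnn.
apply/andP/eqP => [[le' lt']|<-] //.
have := kmin _ lt'; rewrite ltnS => kj; apply/eqP; rewrite eqn_leq kj leqNgt.
by apply/negP => /S_mono lek; have := leq_trans lt (leq_trans lek le'); rewrite ltnn.
Qed.

Variable beta : 'I_N -> 'I_p.
Hypothesis betaE : forall x j, (x \in block n N j) = (beta x == j).

Lemma young_subgroup_beta : young_subgroup n N = block_perm beta.
Proof.
apply/setP => h; rewrite inE; apply/forallP/block_permP => H x.
  have /eqP/setP/(_ (h x)) := H (beta x).
  rewrite mem_imset; last exact: perm_inj.
  by rewrite !betaE eqxx => /esym/eqP.
apply/eqP/setP => y; rewrite -(permKV h y) mem_imset; last exact: perm_inj.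
by rewrite !betaE H.
Qed.

Lemma card_beta i : #|[set j | beta j == i]| = n i.
Proof. by rewrite -card_block; apply: eq_card => x; rewrite inE betaE. Qed.

Hypothesis n_gt0 : forall i, (1 <= n i)%N.

Lemma avg_perm_charpoly (A : {set 'I_p}) (g : 'S_N) : (1 < #|A|)%N ->
  is_cycle_through n A g ->
  #|young_subgroup n N|%:R^-1 *: \sum_(h in young_subgroup n N) perm_charpoly (g * h)%g
  = \prod_i (1 + 'X - (if i \in A then (n i)%:R^-1 *: 'X else 0))
    - \prod_i (if i \in A then - ((n i)%:R^-1 *: 'X) else 1 + 'X) :> {poly algC}.
Proof.
move=> A2 [s [us ss gE cs]].
(* The cycle meets every block of [A] and has [#|A|] entries, so its blocks list [A] without
   repetition. *)
have [ut tE] : uniq (map beta s) /\ map beta s =i A.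
  have sub : {subset enum A <= map beta s}.
    move=> a; rewrite mem_enum => Aa; have := cs a Aa.
    have -> : count (mem (block n N a)) s = count_mem a (map beta s).
      by rewrite count_map; apply: eq_count => x /=; rewrite betaE.
    by move=> c1; rewrite -has_pred1 has_count c1.
  have sz : (size (map beta s) <= size (enum A))%N by rewrite size_map ss cardE.
  have [_ E] := uniq_min_size (enum_uniq _) sub sz.
  split; first exact: leq_size_uniq (enum_uniq _) sub sz.
  by move=> a; rewrite -E mem_enum.
set t := map beta s in ut tE.
have t2 : (1 < size t)%N by rewrite size_map ss.
have YN0 : #|young_subgroup n N|%:R != 0 :> algC.
  rewrite young_subgroup_beta pnatr_eq0 -lt0n; apply/card_gt0P; exists 1%g.
  by apply/block_permP => x; rewrite perm1.
have n0 i : (n i)%:R != 0 :> algC by rewrite pnatr_eq0 -lt0n n_gt0.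
pose c i : {poly algC} := ((n i)%:R^-1)%:P.
have cE i : c (beta i) * #|[set j | beta j == beta i]|%:R = 1.
  by rewrite card_beta -polyC_natr -polyCM mulVf.
have two0 : 2%:R != 0 :> {poly algC}.
  by rewrite -polyC_natr polyC_eq0 pnatr_eq0.
have -> : \sum_(h in young_subgroup n N) perm_charpoly (g * h)%g
   = det_block_sum beta ('X *: perm_mx g).
  rewrite young_subgroup_beta; apply: eq_bigr => h _.
  by rewrite /perm_charpoly perm_mxM -scalemxAl.
rewrite (det_block_sumE two0 cE) -young_subgroup_beta.
rewrite -polyC_natr mul_polyC scalerA mulVf // scale1r.
(* The mean of the permutation matrices factors through the set of blocks, so Sylvester's identity
   reduces the determinant to size [p]. *)
pose J : 'M[{poly algC}]_(N, p) := \matrix_(x, i) (beta x == i)%:R.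
pose D : 'M[{poly algC}]_(p, N) := \matrix_(i, x) ((beta x == i)%:R * c i).
have -> : block_proj beta c = J *m D.
  apply/matrixP => x y; rewrite !mxE (bigD1 (beta x)) //= big1 => [|i ni].
    by rewrite !mxE eqxx mul1r addr0; case: ifP; rewrite ?mul1r ?mul0r.
  by rewrite !mxE eq_sym (negPf ni) mul0r.
rewrite mulmxA det_1D_mulmxC.
have -> : 1%:M + D *m ('X *: perm_mx g *m J) = cycle_mx t
    (fun i => 1 + 'X - (if i \in A then (n i)%:R^-1 *: 'X else 0))
    (fun i => (n i)%:R^-1 *: 'X).
  apply/matrixP => i j; rewrite !mxE.
  transitivity ((i == j)%:R + c i * 'X *
     (\sum_(x | beta x == i) (beta (g x) == j)%:R : {poly algC})).
    congr (_ + _); rewrite mulr_sumr [RHS]big_mkcond /=; apply: eq_bigr => x _.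
    rewrite -scalemxAl -row_permE !mxE.
    by case: ifP; rewrite ?mul0r // mul1r mulrA.
  have cin : #|[pred x | (beta x == i) && (x \in s)]| = (i \in t).
    rewrite -(count_uniq_mem _ ut) count_map -size_filter.
    rewrite -(card_uniqP (filter_uniq _ us)); apply: eq_card => x.
    by rewrite !inE mem_filter.
  have cout : #|[pred x | (beta x == i) && (x \notin s)]| + (i \in t) = n i.
    rewrite -cin -card_beta -(cardID (mem s) [set x | beta x == i]) addnC.
    by congr addn; apply: eq_card => x; rewrite !inE // andbC.
  (* In block [i] every point off the cycle is fixed, and the single entry of [s], if any, goes to
     block [next t i]. *)
  have sumE : \sum_(x | beta x == i) (beta (g x) == j)%:R
     = (i == j)%:R * ((n i)%:R - (i \in A)%:R)
       + ((i \in t) && (next t i == j))%:R :> {poly algC}.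
    rewrite (bigID (mem s)) /= addrC; congr (_ + _).
      rewrite (eq_bigr (fun=> (i == j)%:R)) => [|x /andP[/eqP bx nsx]]; last first.
        by rewrite gE next_nth (negPf nsx) bx.
      rewrite sumr_const -[#|_|]/#|[pred x | (beta x == i) && (x \notin s)]|.
      by rewrite -cout natrD tE addrK mulr_natr.
    rewrite (eq_bigr (fun=> (next t i == j)%:R)) => [|x /andP[/eqP bx sx]]; last first.
      by rewrite gE -next_map_in // bx.
    rewrite sumr_const -[#|_|]/#|[pred x | (beta x == i) && (x \in s)]| cin.
    by case: (i \in t); rewrite ?mulr0n ?mulr1n.
  have cn : c i * (n i)%:R = 1 by rewrite -polyC_natr -polyCM mulVf.
  rewrite sumE -tE -!mul_polyC -/(c i) mulrDr mulrCA mulrBr.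
  rewrite (_ : c i * 'X * (n i)%:R = 'X); last by rewrite mulrAC cn mul1r.
  case: (i == j); case: (i \in t); case: (next t i == j) => /=; ring.
rewrite det_cycle_mx //; congr (_ - _).
by apply: eq_bigr => i _; rewrite tE; case: ifP => // ->; rewrite subr0.
Qed.

End Blocks.

(** * Generating functions *)

Section Algebra.
Local Notation Y := (1 + 'X : {poly algC}).

Lemma elem_symE l k (x : 'I_l -> algC) :
  elem_sym k x = \sum_(h : {set 'I_l} | #|h| == k) \prod_(i in h) x i.
Proof.
rewrite /elem_sym /mesym rmorph_sum; apply: eq_bigr => h _ /=.
by rewrite rmorph_prod; apply: eq_bigr => i _; rewrite /= mevalXU.
Qed.

Lemma elem_sym0 l (x : 'I_l -> algC) : elem_sym 0 x = 1.
Proof.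
rewrite elem_symE (big_pred1 set0) ?big_set0 // => h.
by rewrite cards_eq0.
Qed.

Lemma elem_sym_full l (x : 'I_l -> algC) : elem_sym l x = \prod_i x i.
Proof.
rewrite elem_symE (big_pred1 setT) => [|h].
  by apply: eq_bigl => i; rewrite inE.
have := max_card (mem h); rewrite card_ord => hl.
by rewrite /= eqEcard subsetT cardsT card_ord eqn_leq hl.
Qed.

Lemma prod_elem_sym l (x : 'I_l -> algC) (u v : {poly algC}) :
  \prod_i (u + x i *: v)
    = \sum_(k < l.+1) elem_sym k x *: (v ^+ k * u ^+ (l - k)).
Proof.
under eq_bigr => i _ do rewrite addrC.
rewrite bigA_distr.
(* [inord] never falls back to its default here, as [#|J|] is at most [l]. *)
rewrite (partition_big (fun J : {set 'I_l} => inord #|J| : 'I_l.+1) predT) //=.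
have cJ (J : {set 'I_l}) : (#|J| < l.+1)%N.
  by have := max_card (mem J); rewrite card_ord ltnS.
apply: eq_bigr => k _; rewrite elem_symE scaler_suml.
apply: eq_big => [J|J /eqP/(congr1 val) /=]; first by rewrite -val_eqE /= inordK.
rewrite inordK // => cJk.
rewrite (bigID (mem J)) /= (eq_bigr (fun i => x i *: v)) => [|i ->] //.
rewrite [X in _ * X](eq_bigr (fun=> u)) => [|i /negPf ->] //.
rewrite scaler_prod !prodr_const -scalerAl cJk; congr (_ *: (_ * _ ^+ _)).
rewrite -[#|_|]/#|[predC J]| -cJk.
by have := cardC (mem J); rewrite card_ord => cC; rewrite -[X in (X - _)%N]cC addKn.
Qed.

Lemma coef_Yn k j : (Y ^+ k)`_j = ('C(k, j))%:R.
Proof.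
elim: k j => [|k IH] j; first by rewrite expr0 coef1 bin0n; case: j.
rewrite exprS mulrDl mul1r coefD coefXM !IH; case: j => [|j] /=.
  by rewrite !bin0 addr0.
by rewrite binS natrD.
Qed.

Lemma coef_NXnYn i k j :
  ((- 'X) ^+ i * Y ^+ k)`_j = if (i <= j)%N then (-1) ^+ i * ('C(k, j - i))%:R else 0.
Proof.
have -> : (- 'X) ^+ i * Y ^+ k = (-1) ^+ i *: ('X^i * Y ^+ k).
  by rewrite (exprNn 'X) -mulrA -(signr_odd algC) -signr_odd mulr_sign scaler_sign.
by rewrite coefZ coefXnM coef_Yn; case: ltnP => // _; rewrite mulr0.
Qed.

(** The coefficients of [Q] satisfy the same recursion, which determines its solution by
    induction. *)
Lemma branching_unique (a : nat -> algC) (Q : {poly algC}) p :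
  (forall b, (b < p)%N -> a b + (if b is b'.+1 then a b' else 0) = (Y * Q)`_b) ->
  forall b, (b < p)%N -> a b = Q`_b.
Proof.
move=> H; elim=> [|b IH] lt; have := H _ lt; rewrite mulrDl mul1r coefD coefXM /=.
  by rewrite !addr0.
by rewrite IH ?(ltnW lt) // => /addIr.
Qed.

Lemma pochhammerS (R : pzRingType) (a : R) j :
  pochhammer a j.+1 = pochhammer a j * (a + j%:R).
Proof. by rewrite /pochhammer big_nat_recr //= -natr1 addrA addrK. Qed.

Lemma pochhammer_nat b j :
  pochhammer (b%:R + 1) j / (j`!)%:R = ('C(b + j, b))%:R :> algC.
Proof.
have f0 k : (k`!)%:R != 0 :> algC by rewrite pnatr_eq0 -lt0n fact_gt0.
apply: (canLR (mulfK (f0 _))); apply: (mulIf (f0 b)).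
have := bin_fact (leq_addr j b); rewrite addKn (mulnC b`!) => fE.
rewrite -mulrA -!natrM fE {fE}.
elim: j => [|j IH]; first by rewrite /pochhammer big_geq // mul1r addn0.
rewrite pochhammerS mulrAC IH -addrA nat1r -natrD -natrM addnS factS.
by rewrite mulnC.
Qed.

Lemma pochhammer_vanish (a : algC) m i : (0 < i <= m)%N -> a + i%:R = 1 ->
  pochhammer a m = 0.
Proof.
move=> /andP[i0 im] ai; rewrite /pochhammer (bigD1_seq i) ?iota_uniq //=.
  by rewrite ai subrr mul0r.
by rewrite mem_index_iota i0.
Qed.

Lemma pochhammer_opp m : pochhammer (- m%:R) m = (-1) ^+ m * (m`!)%:R :> algC.
Proof.
rewrite /pochhammer big_add1 /= big_nat_rev /= fact_prod natr_prod.
have -> : (-1) ^+ m = \prod_(0 <= i < m) -1 :> algC by rewrite prodr_const_nat subn0.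
rewrite big_add1 /= -big_split /=.
apply: eq_big_nat => i /andP[_ im]; rewrite add0n subnSK // natrB 1?ltnW //.
by rewrite mulN1r -natr1; ring.
Qed.

End Algebra.

(** * The two expansions of the quotient by [1 + 'X] *)

Section GeneratingFunction.
Local Notation Y := (1 + 'X : {poly algC}).
Variables (p l : nat) (u : 'I_l -> algC).

Definition avg_gf : {poly algC} :=
  (\prod_i (Y + u i *: (- 'X)) - \prod_i (u i *: (- 'X))) * Y ^+ (p - l).

(** In the expansion in the [u i], the term of degree [l] cancels the subtracted product; every
    other term contains [Y ^+ (p - i)], from which one factor is removed. *)
Definition inv_quotient : {poly algC} :=
  \sum_(i < l) elem_sym i u *: ((- 'X) ^+ i * Y ^+ (p - 1 - i)).

Lemma coef_inv_quotient b m : (0 < l)%N -> (b + m = p - 1)%N ->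
  inv_quotient`_b = ('C(b + m, b))%:R
    + \sum_(1 <= i < (minn b (l - 1)).+1)
        (-1) ^+ i * ('C(b + m - i, b - i))%:R * elem_sym i u.
Proof.
move=> l0 bm; rewrite /inv_quotient coef_sum -bm.
pose f i := if (i <= b)%N then
  (-1) ^+ i * ('C(b + m - i, b - i))%:R * elem_sym i u else 0.
transitivity (\sum_(0 <= i < l) f i).
  rewrite big_mkord; apply: eq_bigr => i _; rewrite coefZ coef_NXnYn /f.
  by case: ifP; rewrite ?mulr0 // mulrC.
have le : ((minn b (l - 1)).+1 <= l)%N by lia.
rewrite (big_cat_nat _ le) //= [X in _ + X]big_nat_cond.
rewrite [X in _ + X]big1 => [|i /andP[/andP[bi il] _]]; last first.
  by rewrite /f ifF //; lia.
rewrite addr0 big_ltn // /f /= elem_sym0 !subn0 mul1r mulr1; congr (_ + _).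
by apply: eq_big_nat => i /andP[_ ib]; rewrite ifT //; lia.
Qed.

Hypothesis lp : (l <= p)%N.

Lemma inv_quotientE : Y * inv_quotient = avg_gf.
Proof.
rewrite /avg_gf prod_elem_sym big_ord_recr /= subnn mulr1 scaler_prod.
rewrite -elem_sym_full prodr_const card_ord addrK mulr_suml mulr_sumr.
apply: eq_bigr => i _; rewrite -scalerAr -scalerAl; congr (_ *: _).
rewrite mulrCA -exprS -mulrA -exprD; congr (_ * _ ^+ _).
by have := ltn_ord i; lia.
Qed.

Variable x : 'I_l -> algC.
Hypothesis xu : forall i, x i * u i = 1.

(** The quotient by [1 + 'X] of the terms [e_0 [l = p] - (- 'X)^l (1 + 'X)^(p-l)],
    on which the summand of index [k = p] has no factor [1 + 'X] when [l = p]. *)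
Definition tail_quotient : {poly algC} :=
  if (l < p)%N then - ((- 'X) ^+ l * Y ^+ (p - l - 1)) else \sum_(j < l) (- 'X) ^+ j.

(** Multiplied by [x i], each factor of the first product becomes [1 + (x i - 1) Y], whence the
    elementary symmetric polynomials in [x i - 1]. With [l <= p], the value 0 occurs only at
    [k = l = p], where no factor [Y] is available and [tail_quotient] takes over. *)
Definition direct_quotient : {poly algC} :=
  \sum_(k < l.+1) elem_sym (l - k) (fun i => x i - 1)
      *: (if (k < p)%N then Y ^+ (p - 1 - k) else 0) + tail_quotient.

Lemma direct_quotientE : Y * direct_quotient = (\prod_i x i) *: avg_gf.
Proof.
rewrite /avg_gf scalerAl scalerBr -!scaler_prod.
rewrite (eq_bigr (fun i => 1 + (x i - 1) *: Y)) => [|i _]; last first.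
  rewrite scalerDr scalerA xu scale1r scalerBl scale1r.
  by move: (_ *: _) => z; ring.
rewrite [X in _ - X](eq_bigr (fun=> - 'X)) => [|i _]; last first.
  by rewrite scalerA xu scale1r.
rewrite prodr_const card_ord prod_elem_sym (reindex_inj rev_ord_inj) /=.
rewrite mulrBl mulr_suml /direct_quotient mulrDr mulr_sumr.
have [lep|lp'] := ltnP l p.
  rewrite /tail_quotient lep; congr (_ + _).
    apply: eq_bigr => k _; have := ltn_ord k; rewrite subSS ltnS => kl.
    rewrite expr1n mulr1 -scalerAr -scalerAl ifT ?(leq_ltn_trans kl) //.
    by rewrite -exprS -exprD; congr (_ *: _ ^+ _); lia.
  by rewrite mulrN mulrCA -exprS; congr (- (_ * _ ^+ _)); lia.
have pl : p = l by apply/eqP; rewrite eqn_leq lp'.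
rewrite /tail_quotient pl ltnn subnn expr0 mulr1 !big_ord_recr /= ltnn.
rewrite scaler0 mulr0 addr0 !subSS subnn elem_sym0 !expr0 expr1n !mulr1 scale1r -addrA.
congr (_ + _).
  apply: eq_bigr => k _; rewrite ltn_ord subSS.
  rewrite expr1n !mulr1 -scalerAr -exprS; congr (_ *: _ ^+ _).
  by have := ltn_ord k; lia.
(* Geometric series: [1 - (- 'X)^l] is divisible by [1 + 'X]. *)
have := subrX1 (- 'X : {poly algC}) l.
move=> /(congr1 -%R); rewrite opprB => ->; rewrite -mulNr; congr (_ * _).
by rewrite opprD !opprK addrC.
Qed.

(** Three cases. For [l <= b] the Pochhammer quotient is a binomial coefficient. For [b < l < p]
    both sides vanish, factor number [l - b] of the Pochhammer symbol being 0. For [l = p] its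
    argument is [-m], which gives a sign. *)
Lemma coef_tail_quotient b m : (0 < p)%N -> (b + m = p - 1)%N ->
  tail_quotient`_b
    = (-1) ^+ (l + 1) * (pochhammer (b%:R - l%:R + 1) m / (m`!)%:R).
Proof.
move=> p0 bm; rewrite /tail_quotient; case: ifP => lp'.
  rewrite coefN coef_NXnYn addn1 exprS mulN1r mulNr; congr (- _).
  case: ifP => lb.
    rewrite -natrB // pochhammer_nat; congr (_ * 'C(_, _)%:R); lia.
  rewrite (@pochhammer_vanish _ m (l - b)) ?mul0r ?mulr0 //; first lia.
  by rewrite natrB; [ring|lia].
have pl : p = l by apply/eqP; rewrite eqn_leq lp leqNgt lp'.
have lE : l = (b + m).+1 by lia.
have -> : b%:R - l%:R + 1 = - m%:R :> algC by rewrite lE -natr1 natrD; ring.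
rewrite pochhammer_opp mulfK ?pnatr_eq0 -?lt0n ?fact_gt0 // -exprD coef_sum.
have bl : (b < l)%N by lia.
rewrite (bigD1 (Ordinal bl)) //= big1 => [|j nj].
  have := coef_NXnYn b 0 b; rewrite expr0 mulr1 => ->.
  rewrite leqnn subnn bin0 mulr1 addr0 lE -signr_odd -[RHS]signr_odd.
  by congr (_ ^+ nat_of_bool _); lia.
have := coef_NXnYn j 0 b; rewrite expr0 mulr1 => ->; case: ifP => // jb.
rewrite bin0n subn_eq0; case: leqP => bj; rewrite ?mulr0 //.
by case/eqP: nj; apply/val_inj => /=; lia.
Qed.

Lemma coef_direct_quotient b m : (0 < p)%N -> (b + m = p - 1)%N ->
  direct_quotient`_b
    = \sum_(0 <= k < (minn m l).+1)
           pochhammer (b%:R + 1) (m - k) / ((m - k)`!)%:R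
           * elem_sym (l - k) (fun i => x i - 1)
      + (-1) ^+ (l + 1) * (pochhammer (b%:R - l%:R + 1) m / (m`!)%:R).
Proof.
move=> p0 bm; rewrite coefD (coef_tail_quotient p0 bm) coef_sum; congr (_ + _).
pose f k := if (k <= m)%N then pochhammer (b%:R + 1) (m - k) / ((m - k)`!)%:R
           * elem_sym (l - k) (fun i => x i - 1) else 0.
transitivity (\sum_(0 <= k < l.+1) f k).
  rewrite big_mkord; apply: eq_bigr => k _; rewrite coefZ /f.
  case: (leqP k m) => km.
    rewrite ifT; last by lia.
    rewrite coef_Yn pochhammer_nat mulrC; congr ('C(_, _)%:R * _); lia.
  (* For [m < k < p] the exponent [p - 1 - k] is smaller than [b]. *)
  case: ifP => kp; last by rewrite coef0 mulr0.
  by rewrite coef_Yn bin_small ?mulr0 //; lia.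
have le : ((minn m l).+1 <= l.+1)%N by lia.
rewrite (big_cat_nat _ le) //= [X in _ + X]big_nat_cond.
rewrite [X in _ + X]big1 => [|i /andP[/andP[bi il] _]]; last first.
  by rewrite /f ifF //; lia.
by rewrite addr0; apply: eq_big_nat => i /andP[_ ib]; rewrite /f ifT //; lia.
Qed.

End GeneratingFunction.

Lemma prod_ord_if_lt (R : comNzRingType) (p l : nat) (lp : (l <= p)%N)
    (F : 'I_p -> R) (z : R) :
  \prod_(i < p) (if (i < l)%N then F i else z)
    = (\prod_(i < l) F (widen_ord lp i)) * z ^+ (p - l).
Proof.
rewrite (bigID (fun i : 'I_p => (i < l)%N)) /=; congr (_ * _).
  rewrite (big_ord_narrow lp); apply: eq_bigr => i _ /=.
  by rewrite ltn_ord.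
rewrite (eq_bigr (fun=> z)) => [|i /negPf -> //]; rewrite prodr_const.
congr (_ ^+ _); rewrite -(@card_ord_itv p l p) // -cardsE.
by apply: eq_card => i; rewrite !inE ltn_ord andbT unfold_in /= -leqNgt.
Qed.

Lemma card_ord_lt (p l : nat) : (l <= p)%N -> #|[set a : 'I_p | (a < l)%N]| = l.
Proof.
by move=> lp; rewrite -[RHS]subn0 -(@card_ord_itv p 0 l).
Qed.

(** * Averaged hook characters and the two formulas *)

Lemma char_avg_branching (p : nat) (n : 'I_p -> nat) (N b : nat) (g : 'S_N) :
  (b < N)%N ->
  char_avg n (sym_char N (hook N b)) g
    + (if b is b'.+1 then char_avg n (sym_char N (hook N b')) g else 0)
  = (#|young_subgroup n N|%:R^-1
      *: \sum_(h in young_subgroup n N) perm_charpoly (g * h)%g)`_b.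
Proof.
move=> bN; rewrite coefZ coef_sum /char_avg.
rewrite (_ : (if b is _.+1 then _ else _) = #|young_subgroup n N|%:R^-1 *
  \sum_(h in young_subgroup n N)
     (if b is b'.+1 then sym_char N (hook N b') (g * h)%g else 0)); last first.
  by case: (b) => //; rewrite big1 ?mulr0.
rewrite -mulrDr -big_split; congr (_ * _); apply: eq_bigr => h _ /=.
exact: sym_char_hook_branching.
Qed.

Unset Implicit Arguments.

Theorem theorem1p1 (p : nat) (hp : (2 <= p)%N)
    (n : 'I_p -> nat) (hn : forall i, (1 <= n i)%N)
    (N : nat) (hN : N = (\sum_(i < p) n i)%N)
    (b : nat) (hb : (b + 1 <= p)%N) (m : nat) (hm : m = (p - b - 1)%N)
    (l : nat) (hl2 : (2 <= l)%N) (hlp : (l <= p)%N)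
    (g : 'S_N) (hg : is_cycle_through n [set a : 'I_p | (a < l)%N] g) :
  let n_ (i : 'I_l) : algC := (n (widen_ord hlp i))%:R in
  char_avg n (sym_char N (hook N b)) g
    = (\prod_(i < l) n_ i)^-1
      * (\sum_(0 <= k < (minn m l).+1)
           pochhammer (b%:R + 1) (m - k) / ((m - k)`!)%:R
           * elem_sym (l - k) (fun i => n_ i - 1)
         + (-1) ^+ (l + 1) * (pochhammer (b%:R - l%:R + 1) m / (m`!)%:R))
  /\
  char_avg n (sym_char N (hook N b)) g
    = ('C(b + m, b))%:R
      + \sum_(1 <= i < (minn b (l - 1)).+1)
          (-1) ^+ i * ('C(b + m - i, b - i))%:R
          * elem_sym i (fun j => (n_ j)^-1).
Proof.
move=> n_.
have n0 i : n_ i != 0 by rewrite pnatr_eq0 -lt0n.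
(* Since [p <= N], every [c < p] labels a hook to which the branching identity applies. *)
have pN : (p <= N)%N.
  by rewrite hN -[leqLHS]card_ord -sum1_card leq_sum.
pose A := [set a : 'I_p | (a < l)%N].
have A2 : (1 < #|A|)%N by rewrite card_ord_lt.
have [beta betaE] := block_index_exists hN.
pose u (i : 'I_l) := (n_ i)^-1.
have xu i : n_ i * u i = 1 by rewrite mulfV.
have gfE : #|young_subgroup n N|%:R^-1
    *: \sum_(h in young_subgroup n N) perm_charpoly (g * h)%g = avg_gf p u.
  rewrite (avg_perm_charpoly hN betaE hn A2 hg) /avg_gf mulrBl; congr (_ - _).
    rewrite -(prod_ord_if_lt hlp (fun i => (1 + 'X) + (n i)%:R^-1 *: - 'X)).
    by apply: eq_bigr => i _; rewrite inE; case: ifP; rewrite ?subr0 // scalerN.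
  rewrite -(prod_ord_if_lt hlp (fun i => (n i)%:R^-1 *: - 'X)).
  by apply: eq_bigr => i _; rewrite inE; case: ifP; rewrite ?scalerN.
(* Both formulas now follow by exhibiting a quotient of [avg_gf] by [1 + 'X]. *)
have aE Q : (1 + 'X) * Q = avg_gf p u ->
    char_avg n (sym_char N (hook N b)) g = Q`_b.
  move=> QE.
  apply: (@branching_unique (fun c => char_avg n (sym_char N (hook N c)) g) Q p).
    move=> c cp; rewrite QE -gfE; apply: char_avg_branching.
    exact: leq_trans cp pN.
  by rewrite addn1 in hb.
have bm : (b + m = p - 1)%N by lia.
have P0 : \prod_i n_ i != 0 by apply/prodf_neq0.
split.
  rewrite (aE ((\prod_i n_ i)^-1 *: direct_quotient p n_)).
    by rewrite coefZ (coef_direct_quotient hlp _ _ bm) //; lia.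
  by rewrite -scalerAr (direct_quotientE hlp xu) scalerA mulVf // scale1r.
by rewrite (aE _ (inv_quotientE u hlp)) (coef_inv_quotient u (ltnW hl2) bm).
Qed.
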